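(* Suppose $G$ and $H$ are two graphs with adjacency matrices $\mathbf A_G$ and $\mathbf A_H$. Then $\mathrm{CDC}(G)\simeq\mathrm{CDC}(H)$ if and only if there exist two permutation matrices $\mathbf Q$ and $\mathbf R$ such that $\mathbf Q\,\mathbf A_G\,\mathbf R=\mathbf A_H$.
   Context: All graphs are finite, simple and undirected (no loops or multiple edges), with vertex set $\mathcal V=\{1,\dots,n\}$ and edge set $\mathcal E$. The adjacency matrix of $G$ is the symmetric $n\times n$ $(0,1)$-matrix with $(i,j)$ entry $1$ iff $\{i,j\}\in\mathcal E$. The canonical double covering $\mathrm{CDC}(G)$ of $G=(\mathcal V,\mathcal E)$ is the graph with vertex set $\mathcal V\times\{0,1\}$ and edge set $\{\{(u,0),(v,1)\},\{(u,1),(v,0)\} : \{u,v\}\in\mathcal E\}$. $\simeq$ denotes graph isomorphism. The permutation matrices $\mathbf Q$ and $\mathbf R$ are not required to be inverse to each other. *)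

(* Defs.v *)
From HB Require Import structures.
From mathcomp Require Import all_boot all_order all_fingroup all_algebra.

Set Implicit Arguments.
Unset Strict Implicit.
Unset Printing Implicit Defensive.

Import GRing.Theory.
Local Open Scope ring_scope.

(* {u, v} is an edge of G iff adj G u v. *)
Record sgraph (V : finType) := SGraph {
  adj :> rel V;
  adj_sym : symmetric adj;
  adj_irrefl : irreflexive adj }.

Definition graph_iso (V W : finType) (G : sgraph V) (H : sgraph W) : Prop :=
  exists f : V -> W, bijective f /\ forall u v, adj H (f u) (f v) = adj G u v.

Definition adjmx n (G : sgraph 'I_n) : 'M[int]_n :=
  \matrix_(i, j) (adj G i j)%:R.

(* The two layers 0 and 1 of the double covering are false and true. *)
Definition cdc_rel (V : finType) (G : sgraph V) : rel (V * bool)%type :=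
  fun x y => adj G x.1 y.1 && (x.2 != y.2).

Lemma cdc_sym (V : finType) (G : sgraph V) : symmetric (cdc_rel G).
Proof. by move=> x y; rewrite /cdc_rel adj_sym eq_sym. Qed.

Lemma cdc_irrefl (V : finType) (G : sgraph V) : irreflexive (cdc_rel G).
Proof. by move=> x; rewrite /cdc_rel eqxx andbF. Qed.

Definition CDC (V : finType) (G : sgraph V) : sgraph (V * bool)%type :=
  SGraph (cdc_sym G) (cdc_irrefl G).

(* Main.v *)
Require Import Defs.
From mathcomp Require Import all_boot all_order all_fingroup all_algebra.

(** An isomorphism CDC(G) -> CDC(H) need not respect the two layers when
    CDC(G) is disconnected. The layer of CDC(G) and the layer of CDC(H) pulled
    back along the isomorphism are two proper 2-colourings c, c' of CDC(G), and
    each of them is reversed by some automorphism (the exchange of layers).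
    Hence exactly half of all automorphisms a satisfy c (a x) = c x, and exactly
    half satisfy c' (a x) = c x. If c x <> c' x, the identity is in the first
    half only, so some automorphism g is in the second half only. Exchanging
    the components of x and g x along g makes c' agree with c on both of them
    and changes nothing elsewhere, so an automorphism p maximizing the agreement
    of c' \o p with c makes them equal. A layer-preserving isomorphism is a pair
    of bijections, one per layer, and these are the two permutation matrices. *)

Set Implicit Arguments.
Unset Strict Implicit.
Unset Printing Implicit Defensive.

Local Open Scope group_scope.

(** * Automorphisms and proper 2-colourings of a finite graph *)

Section Recolouring.

Variables (T : finType) (e : rel T).
Hypothesis e_sym : symmetric e.

Definition aut_set : {set {perm T}} :=
  [set a : {perm T} | [forall u, forall v, e u v ==> e (a u) (a v)]].

Lemma aut_setP (a : {perm T}) :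
  reflect (forall u v, e u v -> e (a u) (a v)) (a \in aut_set).
Proof.
rewrite inE; apply: (iffP forallP) => [h u v|h u].
  by move/forallP: (h u) => /(_ v)/implyP.
by apply/forallP => v; apply/implyP; apply: h.
Qed.

(* Closure under inverses is automatic by finiteness, so preserving edges in
   one direction is enough. *)
Lemma aut_group_set : group_set aut_set.
Proof.
apply/group_setP; split; first by apply/aut_setP => u v; rewrite !perm1.
move=> a b /aut_setP ha /aut_setP hb; apply/aut_setP => u v uv.
by rewrite !permM; apply/hb/ha.
Qed.

Canonical aut_group := group aut_group_set.

Lemma aut_edge (a : {perm T}) u v : a \in aut_set -> e (a u) (a v) = e u v.
Proof.
move=> aA; apply/idP/idP; last by move/aut_setP: aA; apply.
move: (groupVr aA) => /aut_setP h /h.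
by rewrite !permK.
Qed.

Lemma aut_connect (a : {perm T}) u v :
  a \in aut_set -> connect e (a u) (a v) = connect e u v.
Proof.
have imp b w z : b \in aut_set -> connect e w z -> connect e (b w) (b z).
  move=> /aut_setP hb /connectP [p + ->].
  elim: p w => [|w' p IH] w //= /andP [ww' pth].
  exact: connect_trans (connect1 (hb _ _ ww')) (IH _ pth).
move=> aA; apply/idP/idP; last exact: imp.
by move/(imp _ _ _ (groupVr aA)); rewrite !permK.
Qed.

Definition proper2 (c : T -> bool) := forall u v, e u v -> c u != c v.

Definition reversible (c : T -> bool) :=
  exists2 s, s \in aut_set & forall x, c (s x) = ~~ c x.

Lemma proper2_aut c a : proper2 c -> a \in aut_set -> proper2 (c \o a).
Proof. by move=> hc /aut_setP ha u v /ha /hc. Qed.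

Lemma reversible_aut c a : reversible c -> a \in aut_set -> reversible (c \o a).
Proof.
case=> s sA hs aA; exists (a * s * a^-1); first by rewrite !groupM ?groupV.
by move=> x /=; rewrite !permM permKV hs.
Qed.

(** Both colours change along every edge, so agreement is constant on a component. *)
Lemma proper2_connect c c' u v : proper2 c -> proper2 c' -> connect e u v ->
  (c u == c' u) = (c v == c' v).
Proof.
move=> hc hc' /connectP [p + ->].
elim: p u => [|w p IH] u //= /andP [uw /IH <-].
have := hc _ _ uw; have := hc' _ _ uw.
by case: (c u) (c w) (c' u) (c' w) => [] [] [] [].
Qed.

(** Right multiplication by the reversing automorphism [s] maps the automorphisms sending [x] to
    colour [b] onto the remaining ones. *)
Lemma card_aut_colour c x b : reversible c ->
  #|[set a in aut_set | c (a x) == b]|.*2 = #|aut_set|.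
Proof.
case=> s sA hs; set P := [set a in _ | _].
rewrite -addnn -(cardsID P aut_set); congr addn.
  by rewrite (setIidPr _) //; apply/subsetP => a /setIdP [].
rewrite -(card_imset P (mulIg s)); apply: eq_card => a.
apply/imsetP/setDP => [[a' /setIdP [a'A /eqP ca'] ->]|[aA aP]].
  split; first exact: groupM.
  by apply/negP => /setIdP [_]; rewrite permM hs ca'; case: (b).
exists (a * s^-1); last by rewrite mulgKV.
apply/setIdP; split; first by rewrite groupM ?groupV.
have {aP} : c (a x) != b by apply: contra aP => h; apply/setIdP.
rewrite permM; have := hs (s^-1 (a x)); rewrite permKV => ->.
by case: (c _); case: (b).
Qed.

Lemma exchange_colour c c' x : reversible c -> reversible c' -> c x != c' x ->
  exists2 g, g \in aut_set & c' (g x) = c x /\ c (g x) != c x.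
Proof.
move=> rc rc' xne.
pose P := [set a in aut_set | c (a x) == c x].
pose P' := [set a in aut_set | c' (a x) == c x].
have cardP : #|P| = #|P'|.
  by apply: double_inj; rewrite !card_aut_colour.
have [/subsetP sub|/subsetPn [g]] := boolP (P' \subset P).
  have /eqP eqP : P' == P by rewrite eqEcard cardP leqnn andbT; apply/subsetP.
  have /setIdP [_] : 1 \in P' by rewrite eqP; apply/setIdP; rewrite group1 perm1.
  by rewrite perm1 eq_sym (negPf xne).
case/setIdP => gA /eqP c'g gP; exists g => //; split=> //.
by apply: contra gP => cg; apply/setIdP.
Qed.

(** If [g x] lies in the component of [x], the second branch is never reached and the map is [g] on
    that component alone. *)
Definition swap_comp (g : {perm T}) x z :=
  if connect e x z then g z else if connect e (g x) z then g^-1 z else z.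

Lemma swap_comp_inj g x : g \in aut_set -> injective (swap_comp g x).
Proof.
move=> gA.
have cs : connect_sym e by apply: sym_connect_sym.
(* The tests come in the opposite order, since the component of [x] is sent onto that of [g x]. *)
pose back z :=
  if connect e (g x) z then g^-1 z else if connect e x z then g z else z.
apply: (can_inj (g := back)) => z; rewrite /swap_comp /back.
case: (boolP (connect e x z)) => xz; first by rewrite aut_connect // xz permK.
case: (boolP (connect e (g x) z)) => gxz; last by rewrite (negPf gxz) (negPf xz).
have xgz : connect e x (g^-1 z) by rewrite -(aut_connect _ _ gA) permKV.
rewrite xgz permKV ifN //; apply: contra xz => gxgz.
by apply: connect_trans xgz _; apply: connect_trans gxz; rewrite cs.
Qed.

Lemma swap_comp_aut g x (gA : g \in aut_set) :
  perm (swap_comp_inj (x := x) gA) \in aut_set.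
Proof.
apply/aut_setP => u v uv; rewrite !permE /swap_comp.
have same w : connect e w u = connect e w v.
  exact: (same_connect_r (sym_connect_sym e_sym) (connect1 uv)).
rewrite !same; case: ifP => _; first by rewrite aut_edge.
by case: ifP => _ //; rewrite aut_edge ?groupV.
Qed.

Lemma aut_recolour c c' : proper2 c -> proper2 c' ->
    reversible c -> reversible c' ->
  exists2 p, p \in aut_set & forall x, c' (p x) = c x.
Proof.
move=> pc pc' rc rc'.
pose agree (p : {perm T}) := #|[set z | c z == c' (p z)]|.
case: (arg_maxnP agree (group1 aut_group)) => p /= pA pmax.
exists p => // x; apply/esym/eqP/negPn/negP => xne.
have pc'p := proper2_aut pc' pA.
have [g gA [c'g cg]] := exchange_colour rc (reversible_aut rc' pA) xne.
pose q := perm (swap_comp_inj (x := x) gA).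
have c'g_comp z : connect e x z -> c' (p (g z)) = c z.
  move=> xz; apply/esym/eqP.
  by rewrite -(proper2_connect pc (proper2_aut pc'p gA) xz) /= -c'g.
have := pmax (q * p) (groupM (swap_comp_aut x gA) pA).
rewrite leqNgt => /negP; apply; apply: proper_card.
apply/properP; split; last first.
  exists x; rewrite inE //= permM permE /swap_comp connect0.
  by rewrite c'g_comp.
apply/subsetP => z; rewrite !inE permM permE /swap_comp => /eqP zeq.
case: ifP => xz; first by rewrite c'g_comp.
case: ifP => gxz; last by rewrite zeq.
(* At [g x], hence on its whole component, [c] and [c' \o p] disagree, contrary to [zeq]: no
   agreement is lost here. *)
have := proper2_connect pc pc'p gxz; rewrite /= in c'g *.
by rewrite zeq c'g (negPf cg) eqxx.
Qed.

End Recolouring.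

(** * The layers of the double covering *)

Section Layers.

Variables (V W : finType) (G : sgraph V) (H : sgraph W).

Definition flip (x : V * bool) := (x.1, ~~ x.2).

Lemma flipK : involutive flip.
Proof. by case=> v b; rewrite /flip /= negbK. Qed.

Lemma adj_flip x y : adj (CDC G) (flip x) (flip y) = adj (CDC G) x y.
Proof. by case: x y => [u [|]] [v [|]]. Qed.

Lemma reversible_snd : reversible (adj (CDC G)) snd.
Proof.
exists (perm (inv_inj flipK)); last by move=> x; rewrite permE.
by apply/aut_setP => u v; rewrite !permE adj_flip.
Qed.

Lemma proper2_snd : proper2 (adj (CDC G)) snd.
Proof. by move=> u v /andP []. Qed.

(** The restrictions of [h] to layers 0 and 1 serve as [q] and [r]; the edges between layer 0 and
    layer 1 already encode [G]. *)
Lemma layered_biadjacency (h : V * bool -> W * bool) :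
    injective h -> (forall x, (h x).2 = x.2) ->
    (forall x y, adj (CDC H) (h x) (h y) = adj (CDC G) x y) ->
  exists q r : V -> W,
    [/\ injective q, injective r & forall u v, adj H (q u) (r v) = adj G u v].
Proof.
move=> hI h2 hE; exists (fun u => (h (u, false)).1), (fun u => (h (u, true)).1).
have inj b : injective (fun u => (h (u, b)).1).
  move=> u v uv; suff: h (u, b) = h (v, b) by move/hI => [].
  by apply/eqP; rewrite -pair_eqE /pair_eq uv !h2 /= !eqxx.
split=> // u v.
by have := hE (u, false) (v, true); rewrite /= /cdc_rel !h2 /= !andbT.
Qed.

End Layers.

Lemma graph_iso_biadjacency (V W : finType) (G : sgraph V) (H : sgraph W) :
  graph_iso (CDC G) (CDC H) ->
  exists q r : V -> W,
    [/\ injective q, injective r & forall u v, adj H (q u) (r v) = adj G u v].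
Proof.
case=> f [[f' fK f'K] fE].
(* The exchange of layers of [CDC H], conjugated by [f], reverses the pulled-back layer. *)
have flipfI : injective (f' \o @flip W \o f).
  exact: inj_comp (inj_comp (can_inj f'K) (inv_inj (@flipK W))) (can_inj fK).
have rf : reversible (adj (CDC G)) (snd \o f).
  exists (perm flipfI); last by move=> x /=; rewrite permE /= f'K.
  by apply/aut_setP => u v; rewrite !permE /comp -!fE !f'K adj_flip.
have pf : proper2 (adj (CDC G)) (snd \o f).
  by move=> u v; rewrite -fE; apply: proper2_snd.
have [p pA p2] := aut_recolour (@adj_sym _ (CDC G))
  (@proper2_snd _ G) pf (reversible_snd G) rf.
apply: (@layered_biadjacency _ _ _ _ (f \o p)) => //.
  exact: inj_comp (can_inj fK) perm_inj.
by move=> x y; rewrite /comp fE; apply: aut_edge.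
Qed.

Lemma biadjacency_graph_iso (V W : finType) (G : sgraph V) (H : sgraph W)
    (q r : V -> W) : bijective q -> bijective r ->
    (forall u v, adj H (q u) (r v) = adj G u v) ->
  graph_iso (CDC G) (CDC H).
Proof.
move=> [q' qK q'K] [r' rK r'K] qrE.
exists (fun x => if x.2 then (r x.1, true) else (q x.1, false)); split.
  exists (fun x => if x.2 then (r' x.1, true) else (q' x.1, false)).
    by case=> u [|] /=; rewrite ?qK ?rK.
  by case=> u [|] /=; rewrite ?q'K ?r'K.
case=> u [|] [v [|]]; rewrite /= /cdc_rel /= ?andbF ?andbT //.
by rewrite adj_sym qrE adj_sym.
Qed.

(** * Translation into permutation matrices *)

Local Open Scope ring_scope.

(** [r] is inverted because right multiplication by [perm_mx s] permutes columns by [s^-1]. *)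
Lemma adjmx_permP n (G H : sgraph 'I_n) (q r : 'S_n) :
  (perm_mx q *m adjmx G *m perm_mx r^-1 = adjmx H) <->
  (forall u v, adj G (q u) (r v) = adj H u v).
Proof.
rewrite -row_permE -col_permE; split => [/matrixP h u v|h].
  have := h u v; rewrite !mxE.
  by case: (adj G _ _); case: (adj H _ _).
by apply/matrixP => u v; rewrite !mxE h.
Qed.

(* The orders n and m are not assumed equal; the matrix identity can only hold
   between graphs of the same order, hence the cast along e. *)
Theorem theorem4p2 (n m : nat) (G : sgraph 'I_n) (H : sgraph 'I_m) :
  graph_iso (CDC G) (CDC H) <->
  exists (e : n = m) (Q R : 'M[int]_m),
    [/\ is_perm_mx Q, is_perm_mx R
      & Q *m castmx (e, e) (adjmx G) *m R = adjmx H].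
Proof.
split=> [iso|[e]].
  have e : n = m.
    case: iso => f [/bij_eq_card]; rewrite !card_prod card_bool !card_ord.
    by move/eqP; rewrite eqn_pmul2r // => /eqP.
  case: m / e H iso => H /graph_iso_biadjacency [q [r [qI rI qrE]]].
  (* [q] and [r] go from [G] to [H], but [adjmx_permP] takes maps from [H] to [G]: it is applied to
     both inverses, and its own inversion restores [r]. *)
  exists erefl, (perm_mx (perm qI)^-1), (perm_mx (perm rI)).
  rewrite !perm_mx_is_perm castmx_id -[perm rI]invgK; split=> //.
  apply/adjmx_permP => u v; rewrite -qrE.
  by rewrite -[q _](permE qI) -[r _](permE rI) !permKV.
case: m / e H => H [_ [_ [/is_perm_mxP [q ->] /is_perm_mxP [r ->]]]].
rewrite castmx_id -[r]invgK => /adjmx_permP qrE.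
apply: (@biadjacency_graph_iso _ _ _ _ (q^-1)%g r).
- by exists q; [apply: permKV | apply: permK].
- by exists (r^-1)%g; [apply: permK | apply: permKV].
by move=> u v; rewrite -qrE permKV permK.
Qed.
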